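(* Let $n\ge 2$, let $P=(p_1,\dots,p_n)$, $Q=(q_1,\dots,q_n)\in\Gamma_n$, and let $r,R$ be real numbers with $0<r\le \frac{p_i}{q_i}\le R<\infty$ for all $i\in\{1,\dots,n\}$. Then for every real $s\le -1$, $$\frac{r^{-s}(1+r^2)}{4(1+r)}\,\Phi_s(P\|Q)\ \le\ T(P\|Q)\ \le\ \frac{R^{-s}(1+R^2)}{4(1+R)}\,\Phi_s(P\|Q),$$ and for every real $s\ge 2$, $$\frac{R^{-s}(1+R^2)}{4(1+R)}\,\Phi_s(P\|Q)\ \le\ T(P\|Q)\ \le\ \frac{r^{-s}(1+r^2)}{4(1+r)}\,\Phi_s(P\|Q).$$
   Context: For $n\ge2$, $\Gamma_n=\{P=(p_1,\dots,p_n): p_i>0,\ \sum_{i=1}^n p_i=1\}$. For $P,Q\in\Gamma_n$ and $s\in\mathbb{R}$, the relative information of type $s$ is $\Phi_s(P\|Q)=[s(s-1)]^{-1}\left[\sum_{i=1}^n p_i^s q_i^{1-s}-1\right]$ for $s\ne 0,1$; $\Phi_0(P\|Q)=\sum_{i=1}^n q_i\ln\frac{q_i}{p_i}$; $\Phi_1(P\|Q)=\sum_{i=1}^n p_i\ln\frac{p_i}{q_i}$. The AG-divergence is $T(P\|Q)=\frac12\left[\sum_{i=1}^n \frac{p_i+q_i}{2}\ln\left(\frac{p_i+q_i}{2p_i}\right)+\sum_{i=1}^n \frac{p_i+q_i}{2}\ln\left(\frac{p_i+q_i}{2q_i}\right)\right]$. *)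

(* Defs.v *)
(* MathComp-Analysis; the real line is an arbitrary [K : realType]. *)
From mathcomp Require Import all_boot all_order all_algebra.
From mathcomp Require Import reals exp.

Set Implicit Arguments.
Unset Strict Implicit.
Unset Printing Implicit Defensive.

Import Order.TTheory GRing.Theory Num.Theory.
Local Open Scope ring_scope.

(* Open probability simplex: all weights are strictly positive, so [powR], [ln]
   and division below are only ever evaluated on positive arguments. *)
Definition Gamma (K : realType) (n : nat) (P : 'I_n -> K) : Prop :=
  (forall i, 0 < P i) /\ \sum_(i < n) P i = 1.

(* Relative information of type s. *)
Definition Phi (K : realType) (n : nat) (s : K) (P Q : 'I_n -> K) : K :=
  if s == 0 then \sum_(i < n) Q i * ln (Q i / P i)
  else if s == 1 then \sum_(i < n) P i * ln (P i / Q i)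
  else (s * (s - 1))^-1 * (\sum_(i < n) P i `^ s * Q i `^ (1 - s) - 1).

(* Arithmetic-geometric mean divergence. *)
Definition AG_divergence (K : realType) (n : nat) (P Q : 'I_n -> K) : K :=
  2^-1 * (\sum_(i < n) (P i + Q i) / 2 * ln ((P i + Q i) / (2 * P i))
        + \sum_(i < n) (P i + Q i) / 2 * ln ((P i + Q i) / (2 * Q i))).

(* Main.v *)
Require Import Defs.
From mathcomp Require Import all_boot all_order all_algebra.
From mathcomp Require Import ring lra.
From mathcomp Require Import normedtype derive realfun.
From mathcomp Require Import reals exp.

Import Order.TTheory GRing.Theory Num.Theory.
Import numFieldNormedType.Exports.
Local Open Scope ring_scope.

(** Write x_i = p_i / q_i. Both divergences are Csiszar divergences, that is,
sums of the form \sum_i q_i g(x_i), and the linear terms in the generator g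
can be chosen so that g(1) = g'(1) = 0, because P and Q have the same total
mass (AG_divergenceE, PhiE). The generator f of the AG-divergence and the
generator phi_s of the relative information of type s satisfy

   f''(x) = (1 + x^2) / (4 x^2 (1 + x)),       phi_s''(x) = x^(s - 2),

so the quotient of the second derivatives is

   f''(x) / phi_s''(x) = x^(- s) (1 + x^2) / (4 (1 + x)) = weight s x,

which is the constant of the theorem with r or R replaced by x. The
rational function x (1 + x^2) / (1 + x) increases and (1 + x^2) / (x^2 (1 + x))
decreases on the positive axis. Multiplied by x^(- s - 1) and x^(2 - s)
respectively, each gives the weight up to the factor 4; so the weight is
nondecreasing for s <= - 1 and nonincreasing for s >= 2 (weight_nondecreasing,
weight_nonincreasing), and its extreme values on [r, R] are those at the end
points.

If m <= weight s <= M on [r, R], then m phi_s'' <= f'' <= M phi_s'' there. The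
point 1 lies in [r, R], since the ratios p_i / q_i average to 1 with the
weights q_i (Gamma_ratio_bounds), and the generators and their first
derivatives agree at 1; two applications of the mean value theorem then give
m phi_s <= f <= M phi_s on [r, R] (le_of_derive2_le). Evaluating at x_i,
multiplying by q_i and summing gives the bounds (Phi_AG_sandwich). *)

(** * Comparing functions through their second derivatives *)

(** The difference w = v - u is convex on [a, b] and has a critical zero at c,
so w is minimal there. Concretely, the mean value theorem is used between x and
c for w, and then between the intermediate point and c for w'. *)
Lemma le_of_derive2_le (K : realType) (a b c : K)
    (u u' u'' v v' v'' : K -> K) :
    a <= c -> c <= b ->
    (forall x, a <= x <= b -> is_derive x 1 u (u' x)) ->
    (forall x, a <= x <= b -> is_derive x 1 v (v' x)) ->
    (forall x, a <= x <= b -> is_derive x 1 u' (u'' x)) ->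
    (forall x, a <= x <= b -> is_derive x 1 v' (v'' x)) ->
    u c = v c -> u' c = v' c ->
    (forall x, a <= x <= b -> u'' x <= v'' x) ->
  forall x, a <= x <= b -> u x <= v x.
Proof.
move=> ac cb du dv du' dv' uvc uvc' uv'' x /andP[ax xb].
have mvt (f df : K -> K) y z : a <= y -> y <= z -> z <= b ->
    (forall t, a <= t <= b -> is_derive t 1 f (df t)) ->
    exists2 t, y <= t <= z & f z - f y = df t * (z - y).
  move=> ay yz zb dfP.
  have dyz t : y <= t <= z -> is_derive t 1 f (df t).
    by case/andP=> yt tz; apply: dfP; rewrite (le_trans ay yt) (le_trans tz zb).
  have [||t] := @MVT_segment K f df y z yz.
  - by move=> t; rewrite in_itv /= => /andP[/ltW yt /ltW tz]; apply: dyz; rewrite yt.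
  - apply: derivable_within_continuous => t; rewrite in_itv /= => /dyz dt.
    exact: (@ex_derive _ _ _ _ _ _ _ dt).
  - by rewrite in_itv /= => yt e; exists t.
pose w t := v t - u t; pose w' t := v' t - u' t; pose w'' t := v'' t - u'' t.
have dw t : a <= t <= b -> is_derive t 1 w (w' t).
  by move=> tab; exact: is_deriveB (dv t tab) (du t tab).
have dw' t : a <= t <= b -> is_derive t 1 w' (w'' t).
  by move=> tab; exact: is_deriveB (dv' t tab) (du' t tab).
have w''0 t : a <= t <= b -> 0 <= w'' t.
  by move=> tab; rewrite subr_ge0; exact: uv''.
have w0 : w c = 0 by rewrite /w uvc subrr.
have w'0 : w' c = 0 by rewrite /w' uvc' subrr.
rewrite -subr_ge0 -/(w x).
case: (leP c x) => [cx|/ltW xc].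
  have [t /andP[ct tx]] := mvt _ _ c x ac cx xb dw.
  rewrite w0 subr0 => ->; apply: mulr_ge0; last by rewrite subr_ge0.
  have [z /andP[cz zt]] := mvt _ _ c t ac ct (le_trans tx xb) dw'.
  rewrite w'0 subr0 => ->; apply: mulr_ge0; last by rewrite subr_ge0.
  by apply: w''0; rewrite (le_trans ac cz) (le_trans zt (le_trans tx xb)).
have [t /andP[xt tc]] := mvt _ _ x c ax xc cb dw.
rewrite w0 sub0r => /(canRL (@opprK _)) ->; rewrite -mulNr.
apply: mulr_ge0; last by rewrite subr_ge0.
have [z /andP[tz zc]] := mvt _ _ t c (le_trans ax xt) tc cb dw'.
rewrite w'0 sub0r => ->; apply: mulr_ge0; last by rewrite subr_ge0.
by apply: w''0; rewrite (le_trans ax (le_trans xt tz)) (le_trans zc cb).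
Qed.

(** * Generators of the two divergences *)

(** The logarithm of the arithmetic mean of 1 and x over their geometric mean. *)
Definition log_AG_ratio {K : realType} (x : K) : K :=
  ln (x + 1) - ln 2 - 2^-1 * ln x.
Definition ag_gen {K : realType} (x : K) : K :=
  2^-1 * (x + 1) * log_AG_ratio x.
Definition ag_gen' {K : realType} (x : K) : K :=
  2^-1 * log_AG_ratio x + 4^-1 * (1 - x^-1).
Definition ag_gen'' {K : realType} (x : K) : K :=
  (1 + x ^+ 2) / (4 * x ^+ 2 * (1 + x)).

(** The linear term s (x - 1) disappears when summed over P and Q in the
simplex; it is subtracted so that 1 becomes a critical zero. *)
Definition phi_gen {K : realType} (s x : K) : K :=
  (s * (s - 1))^-1 * (x `^ s - 1 - s * (x - 1)).
Definition phi_gen' {K : realType} (s x : K) : K :=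
  (s - 1)^-1 * (x `^ (s - 1) - 1).

Lemma is_derive1_log_AG_ratio {K : realType} {x : K} : 0 < x ->
  is_derive x 1 log_AG_ratio ((x + 1)^-1 - (2 * x)^-1).
Proof.
move=> x0.
have x10 : 0 < x + 1 by lra.
have dx1 : is_derive x 1 (fun y : K => y + 1) 1.
  have := is_deriveD (is_derive_id x (1 : K)) (is_derive_cst (1 : K) x 1).
  by rewrite addr0.
have dl1 : is_derive x 1 (fun y : K => ln (y + 1)) ((x + 1)^-1).
  rewrite -[_^-1]mulr1.
  exact: (@is_derive1_comp _ (@ln K) (fun y : K => y + 1) x _ _ (is_derive1_ln x10) dx1).
have h := is_deriveB (is_deriveB dl1 (is_derive_cst (ln 2 : K) x 1))
             (is_deriveZ (2^-1) (is_derive1_ln x0)).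
apply: (@is_derive_eq _ _ _ _ _ _ _ _ h).
by rewrite subr0 invfM.
Qed.

Lemma is_derive1_ag_gen {K : realType} {x : K} : 0 < x ->
  is_derive x 1 ag_gen (ag_gen' x).
Proof.
move=> x0.
have h := is_deriveM
  (is_deriveZ (2^-1) (is_deriveD (is_derive_id x (1 : K)) (is_derive_cst (1 : K) x 1)))
  (is_derive1_log_AG_ratio x0).
apply: (@is_derive_eq _ _ _ _ _ _ _ _ h).
rewrite -[LHS]/(2^-1 * (x + 1) * ((x + 1)^-1 - (2 * x)^-1)
  + log_AG_ratio x * (2^-1 * (1 + 0))) /ag_gen'.
by field; lra.
Qed.

Lemma is_derive1_ag_gen' {K : realType} {x : K} : 0 < x ->
  is_derive x 1 ag_gen' (ag_gen'' x).
Proof.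
move=> x0.
have h := is_deriveD (is_deriveZ (2^-1) (is_derive1_log_AG_ratio x0))
  (is_deriveZ (4^-1) (is_deriveB (is_derive_cst (1 : K) x 1)
    (is_deriveV (lt0r_neq0 x0) (is_derive_id x (1 : K))))).
apply: (@is_derive_eq _ _ _ _ _ _ _ _ h).
by rewrite /ag_gen'' /GRing.scale /=; field; lra.
Qed.

Lemma is_derive1_phi_gen {K : realType} {s x : K} : s != 0 -> s != 1 -> 0 < x ->
  is_derive x 1 (phi_gen s) (phi_gen' s x).
Proof.
move=> s0 s1 x0.
have h := is_deriveZ ((s * (s - 1))^-1) (is_deriveB (is_deriveB
  (is_derive1_powR s x0) (is_derive_cst (1 : K) x 1))
  (is_deriveZ s (is_deriveB (is_derive_id x (1 : K)) (is_derive_cst (1 : K) x 1)))).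
apply: (@is_derive_eq _ _ _ _ _ _ _ _ h).
by rewrite /phi_gen' /GRing.scale /=; field; rewrite s0 subr_eq0 s1.
Qed.

Lemma is_derive1_phi_gen' {K : realType} {s x : K} : s != 1 -> 0 < x ->
  is_derive x 1 (phi_gen' s) (x `^ (s - 2)).
Proof.
move=> s1 x0.
have h := is_deriveZ ((s - 1)^-1) (is_deriveB
  (is_derive1_powR (s - 1) x0) (is_derive_cst (1 : K) x 1)).
apply: (@is_derive_eq _ _ _ _ _ _ _ _ h).
rewrite /GRing.scale /= subr0 mulrA mulVf ?subr_eq0// mul1r.
by congr (_ `^ _); ring.
Qed.

(** * Monotonicity of the quotient of the second derivatives *)

(** For x > 0 this is the quotient of the second derivatives of [ag_gen] and
[phi_gen s], see [ag_gen''_weight]. *)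
Definition weight {K : realType} (s x : K) : K :=
  x `^ (- s) * (1 + x ^+ 2) / (4 * (1 + x)).

(** Splitting off one factor x from the power leaves two nonnegative
nondecreasing factors: a power of exponent - s - 1 >= 0 and a rational
function. *)
Lemma weight_nondecreasing {K : realType} {s x y : K} :
  s <= -1 -> 0 < x -> x <= y -> weight s x <= weight s y.
Proof.
move=> s1 x0 xy; have y0 := lt_le_trans x0 xy.
have split_weight z : 0 < z ->
    weight s z = z `^ (- s - 1) * (z * (1 + z ^+ 2) / (4 * (1 + z))).
  move=> z0; rewrite /weight -(@mulr_powRB1 _ z (- s)) ?ltW//; last by lra.
  by field; lra.
rewrite !split_weight//; apply: ler_pM.
- exact: powR_ge0.
- by rewrite divr_ge0 ?mulr_ge0 ?addr_ge0 ?sqr_ge0 ?ltW.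
- by apply: ge0_ler_powR; rewrite ?nnegrE//; lra.
- rewrite ler_pdivrMr ?mulr_gt0 ?addr_gt0// mulrAC ler_pdivlMr ?mulr_gt0 ?addr_gt0//.
  rewrite -subr_ge0.
  have -> : y * (1 + y ^+ 2) * (4 * (1 + x)) - x * (1 + x ^+ 2) * (4 * (1 + y)) =
    4 * (y - x) * (1 + x ^+ 2 + x * y + y ^+ 2 + x * y * (x + y)) by ring.
  have [x_ge0 y_ge0] := (ltW x0, ltW y0).
  by rewrite mulr_ge0 ?mulr_ge0 ?subr_ge0// !(addr_ge0, mulr_ge0, sqr_ge0).
Qed.

(** Moving x^2 from the power to the rational function leaves two nonnegative
nonincreasing factors; s >= 2 makes x^(s - 2) nondecreasing. *)
Lemma weight_nonincreasing {K : realType} {s x y : K} :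
  2 <= s -> 0 < x -> x <= y -> weight s y <= weight s x.
Proof.
move=> s2 x0 xy; have y0 := lt_le_trans x0 xy.
have split_weight z : 0 < z ->
    weight s z = (z `^ (s - 2))^-1 * ((1 + z ^+ 2) / (4 * z ^+ 2 * (1 + z))).
  move=> z0; rewrite /weight powRN powRB ?lt0r_neq0 ?implybT// (powR_mulrn 2) ?ltW//.
  have zs0 : z `^ s != 0 by rewrite lt0r_neq0 ?powR_gt0.
  by field; rewrite zs0 /=; lra.
rewrite !split_weight//; apply: ler_pM.
- by rewrite invr_ge0 powR_ge0.
- by rewrite divr_ge0 ?mulr_ge0 ?addr_ge0 ?sqr_ge0 ?ltW.
- rewrite lef_pV2 ?posrE ?powR_gt0//.
  by apply: ge0_ler_powR; rewrite ?nnegrE//; lra.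
- rewrite ler_pdivrMr ?mulr_gt0 ?addr_gt0 ?exprn_gt0// mulrAC.
  rewrite ler_pdivlMr ?mulr_gt0 ?addr_gt0 ?exprn_gt0//.
  rewrite -subr_ge0.
  have -> : (1 + x ^+ 2) * (4 * y ^+ 2 * (1 + y)) -
      (1 + y ^+ 2) * (4 * x ^+ 2 * (1 + x)) =
    4 * (y - x) * (x + y + (x ^+ 2 + x * y + y ^+ 2) + x ^+ 2 * y ^+ 2) by ring.
  have [x_ge0 y_ge0] := (ltW x0, ltW y0).
  by rewrite mulr_ge0 ?mulr_ge0 ?subr_ge0// !(addr_ge0, mulr_ge0, sqr_ge0).
Qed.

Lemma ag_gen''_weight {K : realType} {s x : K} : 0 < x ->
  ag_gen'' x = weight s x * x `^ (s - 2).
Proof.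
move=> x0; have xN0 := lt0r_neq0 x0.
rewrite /weight /ag_gen'' powRN powRB ?xN0 ?implybT// (powR_mulrn 2) ?ltW//.
field; rewrite xN0 !lt0r_neq0 ?powR_gt0//; lra.
Qed.

Lemma ag_gen_at1 {K : realType} : ag_gen (1 : K) = 0 /\ ag_gen' (1 : K) = 0.
Proof.
rewrite /ag_gen /ag_gen' /log_AG_ratio -[1 + 1]/2%:R ln1 invr1; split; ring.
Qed.

Lemma phi_gen_at1 {K : realType} (s : K) : phi_gen s 1 = 0 /\ phi_gen' s 1 = 0.
Proof. by rewrite /phi_gen /phi_gen' powR1; split; ring. Qed.

(** * Comparison of the generators *)

Lemma phi_gen_le_ag_gen {K : realType} (s m r R : K) :
  s != 0 -> s != 1 -> 0 < r -> r <= 1 -> 1 <= R ->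
  (forall x, r <= x <= R -> m <= weight s x) ->
  forall x, r <= x <= R -> m * phi_gen s x <= ag_gen x.
Proof.
move=> s0 s1 r0 r1 R1 mw.
have pos x : r <= x <= R -> 0 < x by move=> /andP[rx _]; exact: lt_le_trans rx.
have [ag1 ag1'] := @ag_gen_at1 K; have [ph1 ph1'] := phi_gen_at1 s.
apply: (@le_of_derive2_le K r R 1 _ (fun x => m * phi_gen' s x)
  (fun x => m * x `^ (s - 2)) ag_gen ag_gen' ag_gen'') => //.
- by move=> x /pos x0; have h := is_deriveZ m (is_derive1_phi_gen s0 s1 x0); exact: h.
- by move=> x /pos x0; exact: is_derive1_ag_gen.
- by move=> x /pos x0; have h := is_deriveZ m (is_derive1_phi_gen' s1 x0); exact: h.
- by move=> x /pos x0; exact: is_derive1_ag_gen'.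
- by rewrite ph1 mulr0.
- by rewrite ph1' mulr0.
- move=> x xrR; rewrite (@ag_gen''_weight _ s) ?pos//.
  by rewrite ler_wpM2r ?powR_ge0// mw.
Qed.

Lemma ag_gen_le_phi_gen {K : realType} (s M r R : K) :
  s != 0 -> s != 1 -> 0 < r -> r <= 1 -> 1 <= R ->
  (forall x, r <= x <= R -> weight s x <= M) ->
  forall x, r <= x <= R -> ag_gen x <= M * phi_gen s x.
Proof.
move=> s0 s1 r0 r1 R1 wM.
have pos x : r <= x <= R -> 0 < x by move=> /andP[rx _]; exact: lt_le_trans rx.
have [ag1 ag1'] := @ag_gen_at1 K; have [ph1 ph1'] := phi_gen_at1 s.
apply: (@le_of_derive2_le K r R 1 ag_gen ag_gen' ag_gen'' _
  (fun x => M * phi_gen' s x) (fun x => M * x `^ (s - 2))) => //.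
- by move=> x /pos x0; exact: is_derive1_ag_gen.
- by move=> x /pos x0; have h := is_deriveZ M (is_derive1_phi_gen s0 s1 x0); exact: h.
- by move=> x /pos x0; exact: is_derive1_ag_gen'.
- by move=> x /pos x0; have h := is_deriveZ M (is_derive1_phi_gen' s1 x0); exact: h.
- by rewrite ph1 mulr0.
- by rewrite ph1' mulr0.
- move=> x xrR; rewrite (@ag_gen''_weight _ s) ?pos//.
  by rewrite ler_wpM2r ?powR_ge0// wM.
Qed.

(** * From the generators to the divergences *)

Lemma AG_divergenceE {K : realType} {n : nat} {P Q : 'I_n -> K} :
  (forall i, 0 < P i) -> (forall i, 0 < Q i) ->
  AG_divergence P Q = \sum_(i < n) Q i * ag_gen (P i / Q i).
Proof.
move=> P0 Q0; rewrite /AG_divergence -big_split mulr_sumr; apply: eq_bigr => i _.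
have [p0 q0] := (P0 i, Q0 i); rewrite /ag_gen /log_AG_ratio.
have -> : P i / Q i + 1 = (P i + Q i) / Q i by field; lra.
rewrite !ln_div ?posrE ?mulr_gt0 ?addr_gt0// !lnM ?posrE//.
by rewrite /=; field; lra.
Qed.

(** The generator contributes the linear term - s (p_i - q_i), whose sum over i
vanishes because P and Q both have total mass 1. *)
Lemma PhiE {K : realType} {n : nat} {s : K} {P Q : 'I_n -> K} :
  Gamma P -> Gamma Q -> s != 0 -> s != 1 ->
  Phi s P Q = \sum_(i < n) Q i * phi_gen s (P i / Q i).
Proof.
move=> [P0 P1] [Q0 Q1] /negbTE s0 /negbTE s1; rewrite /Phi s0 s1.
transitivity ((s * (s - 1))^-1 *
    \sum_(i < n) (P i `^ s * Q i `^ (1 - s) - Q i - s * (P i - Q i))).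
  by rewrite !sumrB -mulr_sumr sumrB P1 Q1 subrr mulr0 subr0.
rewrite mulr_sumr; apply: eq_bigr => i _.
have [p0 q0] := (P0 i, Q0 i).
have -> : Q i `^ (1 - s) = Q i * (Q i)^-1 `^ s.
  rewrite powRB ?lt0r_neq0 ?implybT// powRr1 ?ltW// -powRN.
  by rewrite -powR_inv1 ?ltW// -powRrM mulN1r.
rewrite /phi_gen powRM ?invr_ge0 ?ltW//.
set c := _^-1; field; lra.
Qed.

(** Summing r q_i <= p_i <= R q_i over i gives r <= 1 <= R. This puts the common
critical zero of the generators inside the interval of the ratios. *)
Lemma Gamma_ratio_bounds {K : realType} {n : nat} {P Q : 'I_n -> K} {r R : K} :
  Gamma P -> Gamma Q -> (forall i, r <= P i / Q i /\ P i / Q i <= R) ->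
  r <= 1 /\ 1 <= R.
Proof.
move=> [P0 P1] [Q0 Q1] h; split.
  rewrite -P1 -[r]mulr1 -Q1 mulr_sumr; apply: ler_sum => i _.
  by rewrite -ler_pdivlMr//; case: (h i).
rewrite -P1 -[R]mulr1 -Q1 mulr_sumr; apply: ler_sum => i _.
by rewrite -ler_pdivrMr//; case: (h i).
Qed.

Lemma Phi_AG_sandwich {K : realType} {n : nat} {P Q : 'I_n -> K} {r R m M s : K} :
  Gamma P -> Gamma Q -> 0 < r -> (forall i, r <= P i / Q i /\ P i / Q i <= R) ->
  s != 0 -> s != 1 -> (forall x, r <= x <= R -> m <= weight s x <= M) ->
  m * Phi s P Q <= AG_divergence P Q /\ AG_divergence P Q <= M * Phi s P Q.
Proof.
move=> hP hQ r0 hrR s0 s1 mwM.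
have [r1 R1] := Gamma_ratio_bounds hP hQ hrR.
have [[P0 _] [Q0 _]] := (hP, hQ).
rewrite (PhiE hP hQ s0 s1) (AG_divergenceE P0 Q0) !mulr_sumr.
have xrR i : r <= P i / Q i <= R by apply/andP; exact: hrR.
split; apply: ler_sum => i _.
  rewrite [m * _]mulrCA ler_pM2l//.
  by apply: (@phi_gen_le_ag_gen _ s m r R) => // x /mwM /andP[].
rewrite [M * _]mulrCA ler_pM2l//.
by apply: (@ag_gen_le_phi_gen _ s M r R) => // x /mwM /andP[].
Qed.

Theorem theorem5p3 (K : realType) (n : nat) (hn : (2 <= n)%N)
    (P Q : 'I_n -> K) (hP : Gamma P) (hQ : Gamma Q)
    (r R : K) (hr : 0 < r)
    (hrR : forall i : 'I_n, r <= P i / Q i /\ P i / Q i <= R) :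
  (forall s : K, s <= -1 ->
     r `^ (- s) * (1 + r ^+ 2) / (4 * (1 + r)) * Phi s P Q <= AG_divergence P Q
     /\ AG_divergence P Q <=
        R `^ (- s) * (1 + R ^+ 2) / (4 * (1 + R)) * Phi s P Q)
  /\
  (forall s : K, 2 <= s ->
     R `^ (- s) * (1 + R ^+ 2) / (4 * (1 + R)) * Phi s P Q <= AG_divergence P Q
     /\ AG_divergence P Q <=
        r `^ (- s) * (1 + r ^+ 2) / (4 * (1 + r)) * Phi s P Q).
Proof.
split=> s hs; apply: (Phi_AG_sandwich hP hQ hr hrR).
- by apply/eqP; lra.
- by apply/eqP; lra.
- move=> x /andP[rx xR]; have x0 := lt_le_trans hr rx.
  by rewrite -!/(weight s _) !weight_nondecreasing.
- by apply/eqP; lra.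
- by apply/eqP; lra.
- move=> x /andP[rx xR]; have x0 := lt_le_trans hr rx.
  by rewrite -!/(weight s _) !weight_nonincreasing.
Qed.
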